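(* Let $b\in[H^\infty_d\otimes\mathscr L(\mathcal H)]_1$ be purely contractive. A bounded row operator $X:K(b)\otimes\mathbb C^d\to K(b)$ is a contractive solution to the Gleason problem in $K(b)$ if and only if $$X^*k_w=w^*k_w-B\,b(w)^*\qquad\text{for all }w\in\mathbb B^d,$$ for some contractive Gleason solution $B\in\mathscr L(\mathcal H,K(b)\otimes\mathbb C^d)$ for $b$. This formula defines a surjection $B\mapsto X(B)$ from contractive Gleason solutions $B$ for $b$ onto contractive Gleason solutions $X$ for $K(b)$. If $B$ is extremal then so is $X(B)$.
   Context: Let $d\ge1$ and let $\mathcal H$ be a non-zero complex Hilbert space, finite dimensional or separable; $\mathbb B^d$ is the open unit ball of $\mathbb C^d$, $zw^*:=\sum_jz_j\overline{w_j}$. $[H^\infty_d\otimes\mathscr L(\mathcal H)]_1$ is the closed unit ball of the multiplier algebra of the space $H^2_d\otimes\mathcal H$ of $\mathcal H$-valued functions on $\mathbb B^d$ with reproducing kernel $\frac1{1-zw^*}I_{\mathcal H}$; $b$ is purely contractive if $\|b(z)\|<1$ for all $z\in\mathbb B^d$. $K(b)$ is the reproducing kernel Hilbert space of $\mathcal H$-valued functions with kernel $k^b(z,w)=\frac{I-b(z)b(w)^*}{1-zw^*}$, and $k_w=k_w^b:\mathcal H\to K(b)$ is the adjoint of evaluation at $w$; $w^*k_w:\mathcal H\to K(b)\otimes\mathbb C^d$ is $w^*k_wh=(\overline{w_1}k_wh,\dots,\overline{w_d}k_wh)^T$. A row operator $X=(X_1,\dots,X_d)\in\mathscr L(K(b)\otimes\mathbb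 C^d,K(b))$ solves the Gleason problem in $K(b)$ if $\sum_jz_j(X_j^*f)(z)=f(z)-f(0)$ for all $f\in K(b)$, $z\in\mathbb B^d$; it is contractive (as a Gleason solution for $K(b)$) if $XX^*\le I-k_0^b(k_0^b)^*$, and extremal if equality holds. $B=(b_1,\dots,b_d)^T\in\mathscr L(\mathcal H,K(b)\otimes\mathbb C^d)$ is a Gleason solution for $b$ if $b(z)h-b(0)h=\sum_jz_j(b_jh)(z)$ for all $z\in\mathbb B^d,h\in\mathcal H$; it is contractive if $B^*B\le I-b(0)^*b(0)$, and extremal if equality holds. *)

(* Defs.v *)
From HB Require Import structures.
From mathcomp Require Import all_boot all_order all_algebra.
From mathcomp Require Import complex ring lra.
From mathcomp Require Import all_classical all_reals topology normedtype.
Set Implicit Arguments.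
Unset Strict Implicit.
Unset Printing Implicit Defensive.
Import Order.TTheory GRing.Theory Num.Theory Num.Def.
Import numFieldNormedType.Exports.
Local Open Scope classical_set_scope.
Local Open Scope ring_scope.

(* Inner products are linear in the first argument. The scalars, and hence the
   values of the norm, live in R[i], where x <= y means that y - x is a
   nonnegative real. *)
HB.mixin Record isHilbert (R : realType) V & CompleteNormedModule R[i] V := {
  hform : {dot V for (@conjC R[i])} ;
  hform_norm : forall x : V, `|x| ^+ 2 = hform x x
}.

#[short(type="hilbertType")]
HB.structure Definition Hilbert (R : realType) :=
  {V of CompleteNormedModule R[i] V & isHilbert R V}.

Definition hdot (R : realType) (V : hilbertType R) (x y : V) : R[i] := hform x y.
Notation "''[' x , y ]" := (hdot x y) : ring_scope.

Section HilbertTheory.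
Variables (R : realType) (V : hilbertType R).
Implicit Types (x y z : V) (a : R[i]).

Lemma hdotC x y : '[x, y] = conjC '[y, x].
Proof. by rewrite /hdot hermC expr0 mul1r. Qed.
Lemma hdotDl x y z : '[x + y, z] = '[x, z] + '[y, z].
Proof. by rewrite /hdot linearDl. Qed.
Lemma hdotZl a x z : '[a *: x, z] = a * '[x, z].
Proof. by rewrite /hdot linearZl_LR. Qed.
Lemma hdotDr x y z : '[x, y + z] = '[x, y] + '[x, z].
Proof. by rewrite /hdot linearDr. Qed.
Lemma hdotZr a x z : '[x, a *: z] = conjC a * '[x, z].
Proof. by rewrite /hdot linearZr_LR. Qed.
Lemma hdotxx x : '[x, x] = `|x| ^+ 2.
Proof. by rewrite hform_norm. Qed.
End HilbertTheory.

Section DotNorm.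
Variables (C : numClosedFieldType) (U : lmodType C) (f : {dot U for (@conjC C)}).

Lemma ddotZ a u : f (a *: u) (a *: u) = `|a| ^+ 2 * f u u.
Proof. by rewrite linearZl_LR linearZr_LR /= mulrA normCK. Qed.

Lemma dot_cauchy_schwarz u v : `|f u v| ^+ 2 <= f u u * f v v.
Proof.
have [->|v0] := eqVneq v 0; first by rewrite !linear0r normr0 expr0n mulr0.
have fv : f v v != 0 by rewrite dnorm_eq0.
pose a := f u v / f v v.
have o1 : f (u - a *: v) (a *: v) = 0.
  by rewrite linearZr_LR /= linearBl /= linearZl_LR /= divfK // subrr mulr0.
rewrite -[X in f X X * _](subrK (a *: v)) hnormDd //= ddotZ.
rewrite -[f u v](divfK fv) -/a normrM exprMn mulrDl -[X in X <= _]add0r.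
rewrite (ger0_norm (dnorm_ge0 f v)) [f v v ^+ 2]expr2 [X in _ + X <= _]mulrA.
by apply: lerD; rewrite ?mulr_ge0 ?dnorm_ge0.
Qed.

Lemma dot_triangle u v :
  sqrtC (f (u + v) (u + v)) <= sqrtC (f u u) + sqrtC (f v v).
Proof.
rewrite -ler_sqr ?nnegrE ?addr_ge0 ?sqrtC_ge0 // sqrrD !sqrtCK dnormD addrAC.
rewrite lerD2r lerD2l.
have -> : f u v + (f u v)^*%R = 'Re (f u v) *+ 2.
  by rewrite ReE -mulr_natr divfK // pnatr_eq0.
rewrite lerMn2r /=. 
apply: le_trans (real_ler_norm (Creal_Re _)) _.
apply: le_trans (leif_normC_Re_Creal _) _.
rewrite -ler_sqr ?nnegrE ?mulr_ge0 ?sqrtC_ge0 // exprMn !sqrtCK.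
exact: dot_cauchy_schwarz.
Qed.
End DotNorm.

(* V (x) C^n: the l^2 direct sum of n copies of V. *)
Definition dsum (R : realType) (V : hilbertType R) (n : nat) := {ffun 'I_n -> V}.
HB.instance Definition _ (R : realType) (V : hilbertType R) n :=
  GRing.Lmodule.on (dsum V n).
Section DirectSum.
Variables (R : realType) (V : hilbertType R) (n : nat).
Implicit Types (x y : dsum V n).
Definition dsum_dot x y : R[i] := \sum_(i < n) '[x i, y i].

Lemma dsum_dotC x y : dsum_dot x y = conjC (dsum_dot y x).
Proof. by rewrite rmorph_sum; apply: eq_bigr => i _; exact: hdotC. Qed.

Lemma dsum_dot_bilinear :
  bilinear_for *%R (conjC \; *%R) dsum_dot.
Proof.
have L z : scalar (dsum_dot^~ z).
  move=> a x y; rewrite /dsum_dot mulr_sumr -big_split; apply: eq_bigr => i _.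
  by rewrite !ffunE hdotDl hdotZl.
split=> // u a x y /=.
by rewrite dsum_dotC L rmorphD rmorphM (dsum_dotC u x) (dsum_dotC u y).
Qed.

HB.instance Definition _ := bilinear_isBilinear.Build R[i] (dsum V n) (dsum V n)
  R[i] *%R (conjC \; *%R) dsum_dot dsum_dot_bilinear.

Lemma dsum_dot_hermitian x y :
  dsum_dot x y = (-1) ^+ false * conjC (dsum_dot y x).
Proof. by rewrite expr0 mul1r dsum_dotC. Qed.

HB.instance Definition _ := isHermitianSesquilinear.Build R[i] (dsum V n)
  false conjC dsum_dot dsum_dot_hermitian.

Lemma dsum_dot_pos x : x != 0 -> 0 < dsum_dot x x.
Proof.
move=> x0; have [i xi0] : exists i, x i != 0.
  apply/existsP; apply: contraNT x0 => /existsPn x0.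
  by apply/eqP/ffunP => i; rewrite ffunE; apply/eqP; have := x0 i; rewrite negbK.
rewrite /dsum_dot (bigD1 i) //= ltr_wpDr //.
  by apply: sumr_ge0 => j _; rewrite hdotxx exprn_ge0.
by rewrite hdotxx exprn_gt0 // normr_gt0.
Qed.

HB.instance Definition _ := isDotProduct.Build R[i] (dsum V n) dsum_dot
  dsum_dot_pos.

Definition dsum_form : {dot dsum V n for (@conjC R[i])} := dsum_dot.
Definition dsum_norm x : R[i] := sqrtC (dsum_form x x).

Lemma dsum_normZ (a : R[i]) x : dsum_norm (a *: x) = `|a| * dsum_norm x.
Proof.
rewrite /dsum_norm ddotZ sqrtCM ?nnegrE ?exprn_ge0 // sqrCK //.
Qed.
Lemma dsum_norm_eq0 x : dsum_norm x = 0 -> x = 0.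
Proof. by move/eqP; rewrite sqrtC_eq0 dnorm_eq0 => /eqP. Qed.

HB.instance Definition _ := Lmodule_isNormed.Build R[i] (dsum V n)
  (dot_triangle dsum_form) dsum_normZ dsum_norm_eq0.

Lemma dsum_normE x : `|x| ^+ 2 = dsum_form x x.
Proof. by rewrite -[`|x|]/(dsum_norm x) /dsum_norm sqrtCK. Qed.

Lemma dsum_coord_le x i : `|x i| <= `|x|.
Proof.
rewrite -ler_sqr ?nnegrE // dsum_normE /= /dsum_dot (bigD1 i) //= hdotxx.
by rewrite lerDl sumr_ge0 // => j _; rewrite hdotxx exprn_ge0.
Qed.

Lemma dsum_norm_le x : `|x| <= \sum_i `|x i|.
Proof.
rewrite -ler_sqr ?nnegrE ?sumr_ge0 // dsum_normE /= /dsum_dot.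
rewrite expr2 mulr_suml ler_sum // => i _.
rewrite hdotxx expr2 ler_wpM2l // (bigD1 i) //= lerDl.
by rewrite sumr_ge0.
Qed.

Lemma dsum_complete (F : set_system (dsum V n)) :
  ProperFilter F -> cauchy F -> cvg F.
Proof.
move=> FF /cauchy_ballP Fc.
have cF i : cvg ((fun x : dsum V n => x i) @ F).
  apply/cauchy_cvgP/cauchy_ballP => e e0.
  have [[A B] /= [FA FB] AB] := Fc e e0.
  exists ((fun x : dsum V n => x i) @` A, (fun x : dsum V n => x i) @` B) => /=.
    by split; [apply: filterS FA|apply: filterS FB] => x Ax /=; exists x.
  move=> [_ _] /= [[x Ax <-] [y By <-]].
  have /= := AB (x, y) (conj Ax By).
  rewrite -!ball_normE /ball_ /= => /(le_lt_trans _); apply.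
  by have := dsum_coord_le (x - y) i; rewrite !ffunE.
pose l : dsum V n := [ffun i => lim ((fun x : dsum V n => x i) @ F) : V].
apply/cvg_ex; exists l.
apply/cvgrPdist_lt => e e0.
have e1 : 0 < e / n.+1%:R by rewrite divr_gt0.
have : \forall x \near F, forall i : 'I_n, `|l i - (x : dsum V n) i| < e / n.+1%:R.
  apply: filter_forall => i; have /cvgrPdist_lt/(_ _ e1) := cF i.
  by rewrite ffunE.
apply: filterS => x lx.
apply: le_lt_trans (dsum_norm_le _) _.
apply: (@le_lt_trans _ _ (\sum_(i < n) e / n.+1%:R)).
  by apply: ler_sum => i _; have := ltW (lx i); rewrite !ffunE.
rewrite sumr_const card_ord -[X in X < _]mulr_natr mulrAC ltr_pdivrMr //.
by rewrite ltr_pM2l // ltr_nat.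
Qed.

HB.instance Definition _ := Uniform_isComplete.Build (dsum V n) dsum_complete.
HB.instance Definition _ := isHilbert.Build R (dsum V n) dsum_normE.
End DirectSum.

Lemma hilbert_cauchy_schwarz (R : realType) (V : hilbertType R) (x y : V) : `|'[x, y]| <= `|x| * `|y|.
Proof.
rewrite -ler_sqr ?nnegrE ?mulr_ge0 // exprMn -!hdotxx.
exact: dot_cauchy_schwarz.
Qed.

(* For linear maps between normed modules, continuity is boundedness
   (linear_bounded_continuous). *)
Record boundedOp (R : realType) (U V : hilbertType R) := BoundedOp {
  bop_fun :> {linear U -> V} ;
  bop_cont : continuous bop_fun
}.
Notation "''L(' U , V )" := (boundedOp U V) (format "''L(' U ,  V )").

Section Adjoint.
Variables (R : realType) (U V : hilbertType R) (T : 'L(U, V)).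
Implicit Types (x z h : U) (y : V).

Lemma bop_bound : exists2 M : R[i], 0 < M & forall x, `|T x| <= M * `|x|.
Proof.
have /linear_bounded_continuous/linear_boundedP := @bop_cont _ _ _ T.
by move=> /pinfty_ex_gt0 [M M0 TM]; exists M.
Qed.

Section Riesz.
Variable y : V.
Let phi x := '[T x, y].
Let JC x : R[i] := '[x, x] - (phi x + conjC (phi x)).
Let J x : R := complex.Re (JC x).
Let w z h := '[h, z] - phi h.

Let JCE x : (J x)%:C%C = JC x.
Proof.
rewrite /J RRe_real // /JC rpredB //; first by rewrite hdotxx rpredX // normr_real.
by rewrite CrealE rmorphD /= conjCK addrC.
Qed.
Let JCD z h : JC (z + h) = JC z + '[h, h] + (w z h + conjC (w z h)).
Proof.
rewrite /JC /w /phi !hdotDl !hdotDr (linearD T) /= hdotDl !rmorphD /= rmorphN /= (hdotC z h).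
ring.
Qed.

Let phi_le : exists2 M : R[i], 0 < M & forall x, `|phi x| <= M * `|x|.
Proof.
have [M M0 TM] := bop_bound; exists (M * (`|y| + 1)).
  by rewrite mulr_gt0 // ltr_wpDl.
move=> x; apply: le_trans (hilbert_cauchy_schwarz _ _) _.
rewrite mulrAC; apply: ler_pM => //.
by rewrite lerDl.
Qed.

Let re_le (c : R[i]) : - (c + conjC c) <= `|c| *+ 2.
Proof.
have -> : - (c + conjC c) = 'Re (- c) *+ 2.
  by rewrite -mulr_natr ReE divfK ?pnatr_eq0 // rmorphN -opprD.
rewrite lerMn2r /= -normrN.
by apply: le_trans (real_ler_norm (Creal_Re _)) (leif_normC_Re_Creal _).
Qed.


Let J_bound : exists m : R, forall x, m <= J x.
Proof.
have [M M0 pM] := phi_le.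
have M2 : M ^+ 2 \is Num.real by rewrite rpredX // gtr0_real.
exists (complex.Re (- M ^+ 2)) => x.
rewrite -lecR JCE RRe_real ?rpredN // /JC hdotxx.
have h1 : phi x + conjC (phi x) <= M * `|x| *+ 2.
  have := re_le (- phi x); rewrite rmorphN -opprD opprK normrN => /le_trans; apply.
  by rewrite lerMn2r pM.
rewrite lerBrDl; apply: le_trans (lerD h1 (lexx _)) _.
have h2 : 0 <= (`|x| - M) ^+ 2.
  by apply: real_exprn_even_ge0 => //; rewrite rpredB ?normr_real ?gtr0_real.
rewrite -subr_ge0.
have -> : `|x| ^+ 2 - (M * `|x| *+ 2 - M ^+ 2) = (`|x| - M) ^+ 2 by ring.
exact: h2.
Qed.

Let m := inf (range J).
Let J_ge x : m <= J x.
Proof.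
apply: ge_inf; last by exists x.
by have [b bJ] := J_bound; exists b => _ [z _ <-].
Qed.
Let J_near (e : R) : 0 < e -> exists x, J x < m + e.
Proof.
move=> e0; have hi : has_inf (range J).
  split; first by exists (J 0); exists 0.
  by have [b bJ] := J_bound; exists b => _ [z _ <-].
by have [_ [x _ <-] Jx] := inf_adherent e0 hi; exists x.
Qed.

Let JCN z h : JC (z - h) = JC z + '[h, h] - (w z h + conjC (w z h)).
Proof.
have E1 : '[- h, - h] = '[h, h] by rewrite !hdotxx normrN.
rewrite JCD E1; congr (_ + _); rewrite -[- h]scaleN1r /w hdotZl.
rewrite /phi linearZ /= hdotZl !rmorphB /= !rmorphM /= !rmorphN !rmorph1; ring.
Qed.

Let J_parallel (e : R) x z : J x < m + e -> J z < m + e ->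
  `|x - z| ^+ 2 <= (e *+ 4)%:C%C.
Proof.
move=> Jx Jz; pose h := 2%:R^-1 *: (x - z); pose c := 2%:R^-1 *: (x + z).
have n2 : (2%:R : R[i]) != 0 by rewrite pnatr_eq0.
have xE : x = c + h.
  rewrite /c /h -scalerDr addrACA subrr addr0 -mulr2n -[x *+ 2]scaler_nat.
  by rewrite scalerA mulVf ?scale1r.
have zE : z = c - h.
  rewrite /c /h -scalerBr opprB addrC addrA subrK -mulr2n -[z *+ 2]scaler_nat.
  by rewrite scalerA mulVf ?scale1r.
have hE : '[h, h] *+ 4 = `|x - z| ^+ 2.
  have -> : x - z = 2%:R *: h by rewrite scalerA mulfV ?scale1r.
  by rewrite normrZ exprMn -hdotxx normr_nat; ring.
have E : `|x - z| ^+ 2 = (JC x + JC z - JC c *+ 2) *+ 2.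
  rewrite -hE; move: (JCD c h) (JCN c h); rewrite -xE -zE => -> ->; ring.
rewrite E -!JCE -rmorphMn -rmorphD -rmorphB -rmorphMn lecR.
have := J_ge c; lra.
Qed.

Let F : set_system U :=
  fun A => exists2 e : R, 0 < e & forall x, J x < m + e -> A x.
Let F_proper : ProperFilter F.
Proof.
split; first by move=> [e e0 /=]; have [x Jx] := J_near e0 => /(_ x Jx).
split; first by exists 1.
  move=> A B [e e0 eA] [e' e'0 eB]; exists (Order.min e e').
    by rewrite lt_min e0.
  move=> x Jx; split; [apply: eA|apply: eB]; apply: lt_le_trans Jx _;
    by rewrite lerD2l ge_min lexx ?orbT.
by move=> A B AB [e e0 eA]; exists e => // x /eA /AB.
Qed.

Let F_cauchy : cauchy F.
Proof.
have FF := F_proper.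
apply/cauchy_ballP => e e0.
have eR : (complex.Re e)%:C%C = e by rewrite RRe_real // gtr0_real.
pose r := complex.Re e.
have r0 : 0 < r by rewrite -ltcR eR.
pose d := r ^+ 2 / 8%:R.
have d0 : 0 < d by rewrite divr_gt0 ?exprn_gt0.
exists ([set x | J x < m + d], [set x | J x < m + d]) => /=.
  by split; exists d.
move=> [x z] /= [Jx Jz]; rewrite -ball_normE /ball_ /=.
rewrite -(@ltr_pXn2r _ 2) ?nnegrE ?(ltW e0) //.
apply: le_lt_trans (J_parallel Jx Jz) _.
rewrite -eR -/r -rmorphXn ltcR /d; have := exprn_gt0 2 r0; lra.
Qed.

Let riesz_min : exists z, forall x, J z <= J x.
Proof.
have FF := F_proper.
have [z Fz] : exists z : U, F --> z by apply/cvg_ex; exact: cauchy_cvg F_cauchy.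
have [M M0 pM] := phi_le.
exists z => x; apply: le_trans (J_ge x).
apply/ler_addgt0Pr => e e0.
pose K := `|z| + M.
have K0 : 0 < K by rewrite ltr_wpDl.
have eC : 0 < (e / 4)%:C%C :> R[i] by rewrite ltcR divr_gt0.
pose d := (e / 4)%:C%C / K.
have d0 : 0 < d by rewrite divr_gt0.
have /fcvgrPdist_lt/(_ _ d0) := Fz.
move=> [e' e'0 hz]; have e2 : 0 < Order.min e' (e / 2) by rewrite lt_min e'0 divr_gt0.
have [x' Jx'] := J_near e2.
have /hz : J x' < m + e' by apply: lt_le_trans Jx' _; rewrite lerD2l ge_min lexx.
have {Jx'}Jx' : J x' < m + e / 2.
  by apply: lt_le_trans Jx' _; rewrite lerD2l ge_min lexx orbT.
rewrite distrC; pose h := x' - z; rewrite -/h => hd.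
have wle : `|w z h| <= K * `|h|.
  apply: le_trans (ler_normB _ _) _; rewrite mulrDl.
  by rewrite lerD // mulrC hilbert_cauchy_schwarz.
have Jz : JC z <= JC x' + (e / 2)%:C%C.
  have := JCD z h; rewrite [z + h]addrC subrK => ->.
  have add_pos (a b' c' d' : R[i]) : 0 <= b' -> 0 <= c' + d' -> a <= a + b' + c' + d'.
    by move=> b0 cd0; rewrite -!addrA lerDl addr_ge0.
  have h1 := re_le (w z h).
  have h2 : `|w z h| *+ 2 <= (e / 2)%:C%C.
    have -> : (e / 2)%:C%C = (K * d) *+ 2.
      rewrite /d [K * _]mulrC divfK ?gt_eqF // -rmorphMn; congr (_%:C%C); lra.
    rewrite lerMn2r /=; apply: le_trans wle _.
    by rewrite ler_wpM2l ?(ltW K0) // (ltW hd).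
  have := le_trans h1 h2; rewrite -subr_ge0 opprK addrC => h3.
  by apply: add_pos => //; rewrite hdotxx exprn_ge0.
move: Jz; rewrite -!JCE -rmorphD lecR; lra.
Qed.

Lemma riesz : exists z, forall x, '[T x, y] = '[x, z].
Proof.
have [z zmin] := riesz_min; exists z => x.
apply/eqP; rewrite eq_sym -subr_eq0; apply/negPn/negP => w0.
pose s : R[i] := (`|x| ^+ 2 + 1)^-1.
have s1 : 0 < `|x| ^+ 2 + 1 :> R[i] by rewrite ltr_wpDl ?exprn_ge0.
have s0 : 0 < s by rewrite invr_gt0.
pose c := '[x, z] - '[T x, y]; pose h := - s * conjC c *: x.
have := zmin (z + h); rewrite -lecR !JCE JCD -addrA lerDl.
have -> : w z h = - s * `|c| ^+ 2.
  by rewrite /w /phi linearZ /= !hdotZl normCK -mulrBr -/c; ring.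
have sr : conjC s = s by apply: conj_Creal; rewrite gtr0_real.
have -> : '[h, h] = s * `|c| ^+ 2 * (s * `|x| ^+ 2).
  by rewrite hdotZl hdotZr hdotxx !rmorphM !rmorphN /= conjCK sr normCK; ring.
have -> : conjC (- s * `|c| ^+ 2) = - s * `|c| ^+ 2.
  apply: conj_Creal; apply: rpredM; first by rewrite rpredN gtr0_real.
  by rewrite rpredX // normr_real.
have -> : s * `|c| ^+ 2 * (s * `|x| ^+ 2) + (- s * `|c| ^+ 2 + - s * `|c| ^+ 2)
   = s * `|c| ^+ 2 * (s * `|x| ^+ 2 - 2) by ring.
rewrite pmulr_rge0 ?mulr_gt0 ?exprn_gt0 ?normr_gt0 // subr_ge0.
have : s * `|x| ^+ 2 < 1 by rewrite mulrC ltr_pdivrMr // mul1r ltrDl.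
move=> a1 a2; by have := le_lt_trans a2 a1; rewrite ltrn1.
Qed.
End Riesz.
Lemma hdot_inj (W : hilbertType R) (x z : W) : (forall u, '[u, x] = '[u, z]) -> x = z.
Proof.
move=> xz; have : `|x - z| ^+ 2 = 0.
  by rewrite -hdotxx -[- z]scaleN1r hdotDr hdotZr rmorphN1 mulN1r xz subrr.
by move/eqP; rewrite expf_eq0 /= normr_eq0 subr_eq0 => /eqP.
Qed.

Definition adj_fun y : U := sval (cid (riesz y)).
Lemma adj_funE x y : '[T x, y] = '[x, adj_fun y].
Proof. exact: (svalP (cid (riesz y))). Qed.

Lemma adj_linear : linear adj_fun.
Proof.
move=> a y z; apply: hdot_inj => u.
by rewrite -adj_funE !hdotDr !hdotZr !adj_funE.
Qed.
HB.instance Definition _ := GRing.isLinear.Build R[i] V U *:%R adj_fun adj_linear.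

Lemma adj_cont : continuous adj_fun.
Proof.
apply/linear_bounded_continuous/linear_boundedP.
have [M M0 TM] := bop_bound.
have main y : `|adj_fun y| <= M * `|y|.
  have [->|a0] := eqVneq (adj_fun y) 0.
    by rewrite normr0 mulr_ge0 ?(ltW M0).
  rewrite -(@ler_pM2l _ `|adj_fun y|) ?normr_gt0 // -expr2.
  have -> : `|adj_fun y| ^+ 2 = `|'[T (adj_fun y), y]|.
    by rewrite adj_funE hdotxx ger0_norm ?exprn_ge0.
  apply: le_trans (hilbert_cauchy_schwarz _ _) _.
  by rewrite mulrA [`|adj_fun y| * M]mulrC ler_wpM2r.
near=> r => y; apply: le_trans (main y) _; apply: ler_wpM2r => //.
by near: r; apply: nbhs_pinfty_ge; exact: gtr0_real.
Unshelve. all: by end_near. Qed.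

Definition adj : 'L(V, U) := @BoundedOp R V U adj_fun adj_cont.
Lemma adjE x y : '[T x, y] = '[x, adj y].
Proof. exact: adj_funE. Qed.
End Adjoint.

Lemma bop_eqP (R : realType) (U V : hilbertType R) (S T : 'L(U, V)) :
  S =1 T -> S = T.
Proof.
case: S T => [S Sc] [T Tc] /= ST.
suff E : S = T by subst T; congr BoundedOp; exact: Prop_irrelevance.
case: S T ST {Sc Tc} => [S [[a] [b]]] [T [[c] [e]]] /= ST.
have {ST} E : S = T by apply/funext.
subst T; congr (GRing.Linear.Pack (GRing.Linear.Class _ _));
  congr (_ _); exact: Prop_irrelevance.
Qed.

Section Operators.
Variables (R : realType) (U V W : hilbertType R).
Lemma bcomp_cont (S : 'L(V, W)) (T : 'L(U, V)) : continuous (S \o T).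
Proof.
by move=> x; apply: continuous_comp; apply: bop_cont.
Qed.
Definition bcomp (S : 'L(V, W)) (T : 'L(U, V)) : 'L(U, W) :=
  BoundedOp (@bcomp_cont S T).
(* The real part only moves the norm from R[i] to R. *)
Definition opnorm (T : 'L(U, V)) : R :=
  sup [set complex.Re `|T x| | x in [set x : U | `|x| <= 1]].
End Operators.

Section DirectSumMaps.
Variables (R : realType) (V : hilbertType R) (n : nat) (j : 'I_n).

Definition dsum_inj_fun (v : V) : dsum V n := [ffun i => if i == j then v else 0].
Lemma dsum_inj_linear : linear dsum_inj_fun.
Proof.
move=> a u v; apply/ffunP => i; rewrite !ffunE.
by case: ifP => // _; rewrite scaler0 addr0.
Qed.
HB.instance Definition _ := GRing.isLinear.Build R[i] V (dsum V n) *:%R dsum_inj_fun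
  dsum_inj_linear.
Lemma dsum_inj_cont : continuous dsum_inj_fun.
Proof.
apply/linear_bounded_continuous/linear_boundedP.
near=> r => v; apply: (@le_trans _ _ `|v|).
  apply: le_trans (dsum_norm_le _) _; rewrite (bigD1 j) //= ffunE eqxx.
  by rewrite big1 ?addr0 // => i /negPf ij; rewrite ffunE ij normr0.
rewrite -[X in X <= _]mul1r ler_wpM2r //.
Unshelve. all: by end_near. Qed.
Definition dsum_in : 'L(V, dsum V n) := BoundedOp dsum_inj_cont.

Definition dsum_pr_fun (x : dsum V n) : V := x j.
Lemma dsum_pr_linear : linear dsum_pr_fun.
Proof. by move=> a x y; rewrite /dsum_pr_fun !ffunE. Qed.
HB.instance Definition _ := GRing.isLinear.Build R[i] (dsum V n) V *:%R dsum_pr_fun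
  dsum_pr_linear.
Lemma dsum_pr_cont : continuous dsum_pr_fun.
Proof.
apply/linear_bounded_continuous/linear_boundedP.
near=> r => x; apply: le_trans (dsum_coord_le x j) _.
rewrite -[X in X <= _]mul1r ler_wpM2r //.
Unshelve. all: by end_near. Qed.
Definition dsum_pr : 'L(dsum V n, V) := BoundedOp dsum_pr_cont.
End DirectSumMaps.

(* A reproducing kernel Hilbert space of H-valued functions on T: rk_ev x f is
   the value f(x), evaluations are bounded, and f is determined by its values. *)
Record rkhs (R : realType) (T : Type) (H : hilbertType R) := RKHS {
  rk_space :> hilbertType R ;
  rk_ev : T -> 'L(rk_space, H) ;
  rk_ext : forall f g : rk_space, (forall x, rk_ev x f = rk_ev x g) -> f = g
}.

Section ReproducingKernel.
Variables (R : realType) (T : Type) (H : hilbertType R) (E : rkhs T H).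

Definition ksec (w : T) : 'L(H, E) := adj (rk_ev E w).

Definition has_kernel (k : T -> T -> H -> H) :=
  forall z w h, rk_ev E z (ksec w h) = k z w h.
End ReproducingKernel.

Definition op_le (R : realType) (V : hilbertType R) (S T : V -> V) :=
  forall x, '[S x, x] <= '[T x, x].

Definition finite_dimensional (R : realType) (V : hilbertType R) :=
  exists (n : nat) (e : 'I_n -> V),
    forall x, exists c : 'I_n -> R[i], x = \sum_(i < n) c i *: e i.

Definition separable_space (T : topologicalType) :=
  exists2 A : set T, countable A & dense A.

Section UnitBall.
Variables (R : realType) (d : nat).

Definition cdot (z w : 'rV[R[i]]_d) : R[i] := \sum_(j < d) z 0 j * conjC (w 0 j).

Definition cball := {z : 'rV[R[i]]_d | cdot z z < 1}.

Lemma cdot0_lt1 : cdot 0 0 < 1.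
Proof. by rewrite /cdot big1 ?ltr01 // => j _; rewrite mxE mul0r. Qed.

Definition cball0 : cball := exist _ 0 cdot0_lt1.

Definition zcoord (z : cball) (j : 'I_d) : R[i] := sval z 0 j.
End UnitBall.

Section Gleason.
Variables (R : realType) (d : nat) (H : hilbertType R).
Local Notation Bd := (cball R d).
Local Notation Bd0 := (cball0 R d).

Definition drury_arveson_kernel (z w : Bd) (h : H) : H :=
  (1 - cdot (sval z) (sval w))^-1 *: h.

(* D stands for the space H^2_d (x) H of kernel drury_arveson_kernel; M is the
   operator of multiplication by b. *)
Definition multiplier_unit_ball (D : rkhs Bd H) (b : Bd -> 'L(H, H)) :=
  exists M : 'L(D, D),
    (forall F z, rk_ev D z (M F) = b z (rk_ev D z F)) /\ opnorm M <= 1.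

Definition purely_contractive (b : Bd -> 'L(H, H)) :=
  forall z, opnorm (b z) < 1.

Definition debranges_rovnyak_kernel (b : Bd -> 'L(H, H)) (z w : Bd) (h : H)
    : H :=
  (1 - cdot (sval z) (sval w))^-1 *: (h - b z (adj (b w) h)).

Variables (K : rkhs Bd H).

Definition row_entry (X : 'L(dsum K d, K)) (j : 'I_d) : 'L(K, K) :=
  bcomp X (dsum_in K j).

Definition gleason_solution (X : 'L(dsum K d, K)) :=
  forall (f : K) (z : Bd),
    \sum_(j < d) zcoord z j *: rk_ev K z (adj (row_entry X j) f)
    = rk_ev K z f - rk_ev K Bd0 f.

Definition contractive_gleason_solution (X : 'L(dsum K d, K)) :=
  gleason_solution X /\
  op_le (X \o adj X) (fun f => f - ksec K Bd0 (adj (ksec K Bd0) f)).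

Definition extremal_gleason_solution (X : 'L(dsum K d, K)) :=
  gleason_solution X /\
  X \o adj X =1 (fun f => f - ksec K Bd0 (adj (ksec K Bd0) f)).

Variable b : Bd -> 'L(H, H).

Definition col_entry (B : 'L(H, dsum K d)) (j : 'I_d) : 'L(H, K) :=
  bcomp (dsum_pr K j) B.

Definition gleason_solution_for (B : 'L(H, dsum K d)) :=
  forall (z : Bd) (h : H),
    b z h - b Bd0 h = \sum_(j < d) zcoord z j *: rk_ev K z (col_entry B j h).

Definition contractive_gleason_solution_for (B : 'L(H, dsum K d)) :=
  gleason_solution_for B /\
  op_le (adj B \o B) (fun h => h - adj (b Bd0) (b Bd0 h)).

Definition extremal_gleason_solution_for (B : 'L(H, dsum K d)) :=
  gleason_solution_for B /\
  adj B \o B =1 (fun h => h - adj (b Bd0) (b Bd0 h)).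

Definition wstar_ksec (w : Bd) (h : H) : dsum K d :=
  [ffun j => conjC (zcoord w j) *: ksec K w h].

Definition gleason_formula (B : 'L(H, dsum K d)) (X : 'L(dsum K d, K)) :=
  forall (w : Bd) (h : H),
    adj X (ksec K w h) = wstar_ksec w h - B (adj (b w) h).
End Gleason.

(* Main.v *)
From HB Require Import structures.
Require Import Defs.
From mathcomp Require Import all_boot all_order all_algebra.
From mathcomp Require Import complex ring lra.
From mathcomp Require Import all_classical all_reals topology normedtype.
Set Implicit Arguments.
Unset Strict Implicit.
Unset Printing Implicit Defensive.
Import Order.TTheory GRing.Theory Num.Theory Num.Def.
Import numFieldNormedType.Exports.
Local Open Scope classical_set_scope.
Local Open Scope ring_scope.

(**
Write k_w h for the kernel sections of K(b), c_w h = b(w)^* h, and w^* k_w h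
for the column whose entries are conj(w_j) k_w h. The formula
X^* k_w = w^* k_w - B b(w)^* says that w^* k_w h splits as u + t, with
u = B c_w h and t = X^* k_w h. Each of the operators B and X determines such a
splitting, and the proof passes from one to the other through it.

The Gleason property of either operator gives
<u, z^* k_z g> = <(b(z) - b(0)) c_w h, g>. Together with the kernel identity
(1 - zw^* ) <k_w h, k_z g> = <h, g> - <c_w h, c_z g> and
k_w h (0) = h - b(0) c_w h, it forces, for two indices and with primes for the
second one,

  <k, k'> + <u, u'> + <b(0) c, b(0) c'> = <c, c'> + <t, t'> + <k(0), k'(0)>

(splitting_gram). Both sides are sesquilinear, so the same holds for the norms
of finite linear combinations. Hence |u|^2 + |b(0) c|^2 <= |c|^2 on
combinations if and only if |t|^2 + |k(0)|^2 <= |k|^2 on them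
(splitting_contractive). The first inequality is contractivity of B on the span
of the vectors c, the second is contractivity of X on the span of the vectors
k, and equality in one is equality in the other; this also gives the
extremal case.

It remains to go from spans to whole spaces. A family of vectors t dominated in
norm, combination by combination, by a family a is the image of a under a
bounded operator that vanishes on the orthogonal complement of a
(op_of_family); with a = k this constructs X from B, and with a = c it
constructs B from X. The sections k are total. The vectors c need not be, but b(z) and
b(0) vanish on their orthogonal complement, so taking B = 0 there preserves
both the Gleason property and contractivity (contraction_closed_span).
*)

(** * Inner products *)

Section InnerProduct.
Variables (R : realType) (V : hilbertType R).
Implicit Types (x y z : V).

Lemma hdot0l y : '[0 : V, y] = 0.
Proof. by rewrite -(scale0r 0) hdotZl mul0r. Qed.

Lemma hdotNl x y : '[- x, y] = - '[x, y].
Proof. by rewrite -scaleN1r hdotZl mulN1r. Qed.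

Lemma hdotNr x y : '[x, - y] = - '[x, y].
Proof. by rewrite -scaleN1r hdotZr rmorphN1 mulN1r. Qed.

Lemma hdotBl x y z : '[x - y, z] = '[x, z] - '[y, z].
Proof. by rewrite hdotDl hdotNl. Qed.

Lemma hdotBr x y z : '[x, y - z] = '[x, y] - '[x, z].
Proof. by rewrite hdotDr hdotNr. Qed.

Lemma hdot_suml (I : Type) (r : seq I) (F : I -> V) y :
  '[\sum_(i <- r) F i, y] = \sum_(i <- r) '[F i, y].
Proof.
by apply: (big_morph (fun x => '[x, y])) => [u v|]; rewrite ?hdotDl ?hdot0l.
Qed.

Lemma hdot_sumr (I : Type) (r : seq I) (F : I -> V) x :
  '[x, \sum_(i <- r) F i] = \sum_(i <- r) '[x, F i].
Proof.
by rewrite hdotC hdot_suml rmorph_sum; apply: eq_bigr => i _; rewrite [RHS]hdotC.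
Qed.

End InnerProduct.

(** * The Riesz representation theorem on a subspace *)

(** The functional is given by its graph G, a linear relation; that it takes a
single value at each vector of the subspace follows from the bound GM. The representing vector is
the limit of a minimising sequence of x |-> |x|^2 - 2 Re c over (x, c) in G. *)
Section RieszOnSubspace.
Variables (R : realType) (E : hilbertType R) (G : E -> R[i] -> Prop) (M : R[i]).
Implicit Types (x y z : E) (c f : R[i]).
Hypotheses (G0 : G 0 0)
  (GL : forall a x c y e, G x c -> G y e -> G (a *: x + y) (a * c + e))
  (M0 : 0 <= M) (GM : forall x c, G x c -> `|c| <= M * `|x|).

Let JC x (c : R[i]) : R[i] := '[x, x] - (c + conjC c).
Let J x c : R := complex.Re (JC x c).

Let JCE x c : (J x c)%:C%C = JC x c.
Proof.
rewrite /J RRe_real // /JC rpredB //; first by rewrite hdotxx rpredX // normr_real.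
by rewrite CrealE rmorphD /= conjCK addrC.
Qed.

Let J_ge x c : G x c -> complex.Re (- M ^+ 2) <= J x c.
Proof.
move=> Gxc; rewrite -lecR JCE RRe_real ?rpredN ?rpredX ?ger0_real //.
have c2 : c + conjC c <= M * `|x| *+ 2.
  have -> : c + conjC c = 'Re c *+ 2 by rewrite -mulr_natr ReE divfK ?pnatr_eq0.
  rewrite lerMn2r /=; apply: le_trans (GM Gxc).
  by apply: le_trans (real_ler_norm (Creal_Re _)) (leif_normC_Re_Creal _).
rewrite /JC hdotxx lerBrDl; apply: le_trans (lerD c2 (lexx _)) _.
rewrite -subr_ge0.
have -> : `|x| ^+ 2 - (M * `|x| *+ 2 - M ^+ 2) = (`|x| - M) ^+ 2 by ring.
by apply: real_exprn_even_ge0 => //; rewrite rpredB ?normr_real ?ger0_real.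
Qed.

Let S := [set r : R | exists x c, G x c /\ r = J x c].
Let m := inf S.

Let S_lb : has_lbound S.
Proof. by exists (complex.Re (- M ^+ 2)) => _ [x [c [Gxc ->]]]; exact: J_ge. Qed.

Let m_le x c : G x c -> m <= J x c.
Proof. by move=> Gxc; apply: ge_inf => //; exists x, c. Qed.

Let J_near (e : R) : 0 < e -> exists x c, G x c /\ J x c < m + e.
Proof.
move=> e0; have hi : has_inf S by split=> //; exists (J 0 0); exists 0, 0.
by have [_ [x [c [Gxc ->]]] h] := inf_adherent e0 hi; exists x, c.
Qed.

(** Points where J is nearly minimal are close to each other, by the parallelogram
law applied at their midpoint. *)
Let J_parallel (e : R) x c y f : G x c -> G y f ->
  J x c < m + e -> J y f < m + e -> `|x - y| ^+ 2 <= (e *+ 4)%:C%C.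
Proof.
move=> Gx Gy Jx Jy.
have n2 : (2%:R : R[i]) != 0 by rewrite pnatr_eq0.
pose q : R[i] := 2%:R^-1.
have Gq : G (q *: (x + y)) (q * (c + f)).
  have := GL q (GL 1 Gx Gy) G0; by rewrite !addr0 scale1r mul1r.
have cq : conjC q = q by rewrite /q conj_Creal // rpredV realn.
have E1 : `|x - y| ^+ 2 =
    (JC x c + JC y f - JC (q *: (x + y)) (q * (c + f)) *+ 2) *+ 2.
  rewrite -hdotxx /JC hdotZl hdotZr !(hdotDl, hdotDr, hdotNl, hdotNr).
  rewrite !rmorphM !rmorphD /= cq /q; field; rewrite //.
rewrite E1 -!JCE -rmorphMn -rmorphD -rmorphB -rmorphMn lecR.
have := m_le Gq; lra.
Qed.

Let F : set_system E :=
  fun A => exists2 e : R, 0 < e & forall x c, G x c -> J x c < m + e -> A x.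

Let F_proper : ProperFilter F.
Proof.
split; first by move=> [e e0]; have [x [c [Gx Jx]]] := J_near e0 => /(_ x c Gx Jx).
split; first by exists 1.
  move=> A B [e e0 eA] [e' e'0 eB]; exists (Order.min e e').
    by rewrite lt_min e0.
  move=> x c Gx Jx; split; [apply: (eA _ c)|apply: (eB _ c)] => //;
    by apply: lt_le_trans Jx _; rewrite lerD2l ge_min lexx ?orbT.
by move=> A B AB [e e0 eA]; exists e => // x c Gx /(eA _ _ Gx) /AB.
Qed.

Let F_cauchy : cauchy F.
Proof.
have FF := F_proper.
apply/cauchy_ballP => e e0.
have eR : (complex.Re e)%:C%C = e by rewrite RRe_real // gtr0_real.
pose r := complex.Re e.
have r0 : 0 < r by rewrite -ltcR eR.
pose d := r ^+ 2 / 8%:R.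
have d0 : 0 < d by rewrite divr_gt0 ?exprn_gt0.
pose A := [set x | exists2 c, G x c & J x c < m + d].
exists (A, A) => /=.
  by split; exists d => // x c Gx Jx; exists c.
move=> [x y] /= [[c Gx Jx] [f Gy Jy]]; rewrite -ball_normE /ball_ /=.
rewrite -(@ltr_pXn2r _ 2) ?nnegrE ?(ltW e0) //.
apply: le_lt_trans (J_parallel Gx Gy Jx Jy) _.
rewrite -eR -/r -rmorphXn ltcR /d; have := exprn_gt0 2 r0; lra.
Qed.

(** The approximate first-order condition at a near-minimum (x, c): moving along
(y, f) cannot decrease J by more than e. *)
Let J_slope (e : R) x c y f : G x c -> G y f -> J x c < m + e ->
  `|'[y, x] - f| ^+ 2 <= e%:C%C * (`|y| ^+ 2 + 1).
Proof.
move=> Gx Gy Jx.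
pose w := '[y, x] - f; rewrite -/w.
have s1 : 0 < `|y| ^+ 2 + 1 :> R[i] by rewrite ltr_wpDl ?exprn_ge0.
pose s : R[i] := (`|y| ^+ 2 + 1)^-1.
have s0 : 0 < s by rewrite invr_gt0.
have sr : conjC s = s by apply: conj_Creal; rewrite gtr0_real.
(* the step -s conj(w) decreases J by s |w|^2 (2 - s |y|^2) >= s |w|^2 *)
pose a := - s * conjC w.
have := m_le (GL a Gy Gx) => Jm.
have : JC x c - e%:C%C <= JC (a *: y + x) (a * f + c).
  rewrite -!JCE -rmorphB lecR; lra.
have -> : JC (a *: y + x) (a * f + c) =
    JC x c - s * `|w| ^+ 2 * (2 - s * `|y| ^+ 2).
  rewrite normCK -(hdotxx y) /JC !(hdotDl, hdotDr, hdotZl, hdotZr) (hdotC x y).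
  rewrite rmorphD rmorphM /a !rmorphM rmorphN /= conjCK sr /w rmorphB /=.
  ring.
rewrite lerD2l lerN2 => h.
rewrite -ler_pdivrMr // -/s mulrC; apply: le_trans h.
rewrite ler_peMr ?mulr_ge0 ?exprn_ge0 ?(ltW s0) //.
have sy : s * `|y| ^+ 2 <= 1 by rewrite mulrC ler_pdivrMr // mul1r lerDl.
rewrite -subr_ge0 (_ : _ - _ = 1 - s * `|y| ^+ 2) ?subr_ge0 //; ring.
Qed.

(** That z can be approximated from the domain of G makes it unique, and lets the
bound of the functional pass to |z|. *)
Lemma subspace_riesz : exists z,
  (forall e, 0 < e -> exists x c, G x c /\ `|z - x| < e) /\
  (forall x c, G x c -> '[x, z] = c).
Proof.
have FF := F_proper.
have [z Fz] : exists z : E, F --> z by apply/cvg_ex; exact: cauchy_cvg F_cauchy.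
have near_z (e : R[i]) (r : R) : 0 < e -> 0 < r ->
    exists x c, [/\ G x c, `|z - x| < e & J x c < m + r].
  move=> e0 r0; have /fcvgrPdist_lt/(_ _ e0)[e' e'0 hz] := Fz.
  have mr : 0 < Order.min e' r by rewrite lt_min e'0.
  have [x [c [Gx Jx]]] := J_near mr; exists x, c; split=> //.
    by apply: (hz x c) => //; apply: lt_le_trans Jx _; rewrite lerD2l ge_min lexx.
  by apply: lt_le_trans Jx _; rewrite lerD2l ge_min lexx orbT.
exists z; split=> [e e0|y f Gy].
  by have [x [c [? ? _]]] := near_z e 1 e0 ltr01; exists x, c.
apply/eqP; rewrite -subr_eq0 -normr_le0; apply/ler_addgt0Pr => e e0.
rewrite add0r.
have y0 : 0 < `|y| ^+ 2 + 1 :> R[i] by rewrite ltr_wpDl ?exprn_ge0.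
have e2 : 0 < e / 2 by rewrite divr_gt0.
have [x [c [Gx zx Jx]]] :
    exists x c, [/\ G x c, `|z - x| < e / 2 / (`|y| + 1)
    & J x c < m + complex.Re ((e / 2) ^+ 2 / (`|y| ^+ 2 + 1))].
  apply: near_z; first by rewrite divr_gt0 // ltr_wpDl.
  by rewrite -ltcR RRe_real ?gtr0_real // divr_gt0 // exprn_gt0.
have -> : '[y, z] - f = '[y, z - x] + ('[y, x] - f) by rewrite hdotBr; ring.
apply: le_trans (ler_normD _ _) _; rewrite [e]splitr; apply: lerD.
  apply: le_trans (hilbert_cauchy_schwarz _ _) _.
  rewrite mulrC; apply: le_trans (ler_wpM2r _ (ltW zx)) _ => //.
  rewrite mulrAC ler_pdivrMr ?ltr_wpDl // ler_wpM2l ?(ltW e2) //.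
  by rewrite lerDl.
rewrite -ler_sqr ?nnegrE ?(ltW e2) //.
apply: le_trans (J_slope Gx Gy Jx) _.
by rewrite RRe_real ?divfK ?gt_eqF // gtr0_real // divr_gt0 // exprn_gt0.
Qed.

End RieszOnSubspace.

(** * Families of vectors, their combinations and their closed span *)

(** Continuity of |x|^2 - |T x|^2 - |Q x|^2. It is stated with explicit
tolerances, over an abstract field of scalars C, because this is the form in which
it meets in_closed_span below. *)
Lemma sqnorm_defect_continuous (C : numFieldType) (E V W : normedModType C)
    (T : E -> V) (Q : E -> W) :
  continuous T -> continuous Q -> forall p (r : C), 0 < r ->
  exists2 e : C, 0 < e & forall x, `|p - x| < e ->
    `| `|p| ^+ 2 - (`|T p| ^+ 2 + `|Q p| ^+ 2)
      - (`|x| ^+ 2 - (`|T x| ^+ 2 + `|Q x| ^+ 2))| < r.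
Proof.
move=> Tc Qc p r r0.
have sqc (X Y : normedModType C) (f : X -> Y) :
    continuous f -> continuous (fun y => `|f y| ^+ 2).
  move=> fc y; have nf : {for y, continuous (fun y => `|f y|)}.
    apply: (@continuous_comp _ _ _ f (fun r => `|r|)); first exact: fc.
    exact: norm_continuous.
  exact: (continuousM nf nf).
have : {for p, continuous (fun x => `|x| ^+ 2 - (`|T x| ^+ 2 + `|Q x| ^+ 2))}.
  apply: continuousB; first by apply: (sqc _ _ id) => y; exact: cvg_id.
  by apply: continuousD; apply: sqc.
move=> /cvgrPdist_lt/(_ _ r0) /nbhs_ballP [e /= e0 eg].
by exists e => // x px; apply: eg; rewrite -ball_normE.
Qed.

Section Combinations.
Variables (R : realType) (I : Type).
Implicit Types (s : seq (R[i] * I)).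

(** The list s of weighted indices is a formal combination: the same s is
evaluated in several families at once, which is how a relation between their
Gram matrices is transported to their spans. *)
Definition comb (V : hilbertType R) (a : I -> V) s : V :=
  \sum_(p <- s) p.1 *: a p.2.

Definition comb_axpy (k : R[i]) s s' := [seq (k * p.1, p.2) | p <- s] ++ s'.

Lemma comb_axpyE (V : hilbertType R) (a : I -> V) k s s' :
  comb a (comb_axpy k s s') = k *: comb a s + comb a s'.
Proof.
rewrite /comb big_cat big_map scaler_sumr; congr (_ + _).
by apply: eq_bigr => p _; rewrite scalerA.
Qed.

Lemma comb_nil (V : hilbertType R) (a : I -> V) : comb a [::] = 0.
Proof. by rewrite /comb big_nil. Qed.

Lemma comb_single (V : hilbertType R) (a : I -> V) i : comb a [:: (1, i)] = a i.
Proof. by rewrite /comb big_seq1 scale1r. Qed.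

Lemma comb_linear (V W : hilbertType R) (T : 'L(V, W)) (a : I -> V) s :
  T (comb a s) = comb (fun i => T (a i)) s.
Proof. by rewrite /comb linear_sum; apply: eq_bigr => p _; rewrite linearZ. Qed.

Lemma comb_gram (V : hilbertType R) (a : I -> V) s :
  `|comb a s| ^+ 2 =
  \sum_(p <- s) \sum_(q <- s) p.1 * conjC q.1 * '[a p.2, a q.2].
Proof.
rewrite -hdotxx /comb hdot_suml; apply: eq_bigr => p _.
by rewrite hdot_sumr; apply: eq_bigr => q _; rewrite hdotZl hdotZr mulrA.
Qed.

End Combinations.

Section ClosedSpan.
Variables (R : realType) (I : Type) (E : hilbertType R) (a : I -> E).
Implicit Types (x z : E).

Definition in_closed_span z :=
  forall e : R[i], 0 < e -> exists s, `|z - comb a s| < e.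

Lemma in_closed_span_axpy (k : R[i]) x z :
  in_closed_span x -> in_closed_span z -> in_closed_span (k *: x + z).
Proof.
move=> sx sz e e0.
have k1 : 0 < `|k| + 1 by rewrite ltr_wpDl.
have [s xs] := sx (e / 2 / (`|k| + 1)) (divr_gt0 (divr_gt0 e0 (ltr0Sn _ 1)) k1).
have [s' zs] := sz (e / 2) (divr_gt0 e0 (ltr0Sn _ 1)).
exists (comb_axpy k s s'); rewrite comb_axpyE opprD addrACA -scalerBr.
apply: le_lt_trans (ler_normD _ _) _; rewrite [e]splitr; apply: ler_ltD => //.
rewrite normrZ mulrC; apply: le_trans (ler_wpM2r _ (ltW xs)) _ => //.
by rewrite mulrAC ler_pdivrMr // ler_wpM2l ?divr_ge0 ?(ltW e0) // lerDl.
Qed.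

Lemma orth_closed_span x z :
  in_closed_span z -> (forall i, '[a i, x] = 0) -> '[z, x] = 0.
Proof.
move=> sz ax; apply/eqP; rewrite -normr_le0; apply/ler_addgt0Pr => e e0.
have x1 : 0 < `|x| + 1 by rewrite ltr_wpDl.
have [s zs] := sz _ (divr_gt0 e0 x1).
have sx : '[comb a s, x] = 0.
  by rewrite /comb hdot_suml big1 // => p _; rewrite hdotZl ax mulr0.
rewrite add0r -(subrK (comb a s) z) hdotDl sx addr0.
apply: le_trans (hilbert_cauchy_schwarz _ _) _.
apply: le_trans (ler_wpM2r _ (ltW zs)) _ => //.
by rewrite mulrAC ler_pdivrMr // ler_wpM2l ?(ltW e0) // lerDl.
Qed.

Lemma closed_span_inj x z : in_closed_span x -> in_closed_span z ->
  (forall i, '[a i, x] = '[a i, z]) -> x = z.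
Proof.
move=> sx sz axz; apply/eqP; rewrite -subr_eq0 -normr_eq0 -sqrf_eq0 -hdotxx.
apply/eqP; apply: orth_closed_span => [|i]; last by rewrite hdotBr axz subrr.
by rewrite -scaleN1r addrC; apply: in_closed_span_axpy.
Qed.

(** A functional on formal combinations that is bounded by the norm of the
combination depends on that vector only, hence is represented by a vector of
the closed span. *)
Lemma closed_span_riesz (phi : seq (R[i] * I) -> R[i]) (M : R[i]) :
  phi [::] = 0 ->
  (forall k s s', phi (comb_axpy k s s') = k * phi s + phi s') ->
  0 <= M -> (forall s, `|phi s| <= M * `|comb a s|) ->
  exists z, [/\ in_closed_span z, `|z| <= M & forall s, '[comb a s, z] = phi s].
Proof.
move=> phi0 phiL M0 phiM.
pose G x c := exists s, x = comb a s /\ c = phi s.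
have [||||z [zG Gz]] := @subspace_riesz R E G M.
- by exists [::]; rewrite comb_nil.
- move=> k x c y e [s [-> ->]] [s' [-> ->]].
  by exists (comb_axpy k s s'); rewrite comb_axpyE phiL.
- by [].
- by move=> x c [s [-> ->]].
have sz : in_closed_span z.
  by move=> e /zG [x [c [[s [-> _]] zs]]]; exists s.
have zs s : '[comb a s, z] = phi s by apply: Gz; exists s.
exists z; split=> //.
have [->|z0] := eqVneq z 0; first by rewrite normr0.
have nz : 0 < `|z| by rewrite normr_gt0.
apply/ler_addgt0Pr => e e0.
have M1 : 0 < `|z| + M by rewrite ltr_wpDr.
have [s ze] := sz (e * `|z| / (`|z| + M)) (divr_gt0 (mulr_gt0 e0 nz) M1).
rewrite -(ler_pM2r nz) mulrDl -expr2.
have -> : `|z| ^+ 2 = `|'[z - comb a s, z] + phi s|.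
  by rewrite -zs -hdotDl subrK hdotxx normrX normr_id.
apply: le_trans (ler_normD _ _) _.
apply: le_trans (lerD (hilbert_cauchy_schwarz _ _) (phiM s)) _.
have : `|comb a s| <= `|z| + `|z - comb a s|.
  by rewrite -lerBlDl distrC; apply: lerB_dist.
move=> /(ler_wpM2l M0) h; apply: le_trans (lerD (lexx _) h) _.
rewrite mulrDr addrCA lerD2l [M * _]mulrC -mulrDr.
by rewrite -ler_pdivlMr // (ltW ze).
Qed.

Lemma closed_span_proj x :
  exists2 p, in_closed_span p & forall i, '[a i, x - p] = 0.
Proof.
have [||||p [sp _ ap]] :=
    @closed_span_riesz (fun s => '[comb a s, x]) `|x|.
- by rewrite comb_nil hdot0l.
- by move=> k s s'; rewrite comb_axpyE hdotDl hdotZl.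
- by [].
- by move=> s; rewrite mulrC; exact: hilbert_cauchy_schwarz.
exists p => // i; have := ap [:: (1, i)].
by rewrite comb_single hdotBr => ->; rewrite subrr.
Qed.

(** By continuity the inequality passes to the closed span, and by Pythagoras from
there to the whole space, the orthogonal part contributing only to the right
hand side. *)
Lemma contraction_closed_span (V W : hilbertType R)
    (T : 'L(E, V)) (Q : 'L(E, W)) x :
  (forall s, `|T (comb a s)| ^+ 2 + `|Q (comb a s)| ^+ 2 <= `|comb a s| ^+ 2) ->
  (forall y, (forall i, '[a i, y] = 0) -> T y = 0 /\ Q y = 0) ->
  `|T x| ^+ 2 + `|Q x| ^+ 2 <= `|x| ^+ 2.
Proof.
move=> le_s orth0.
have [p sp xp] := closed_span_proj x.
have [Txp Qxp] := orth0 _ xp.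
have [Tx Qx] : T x = T p /\ Q x = Q p.
  by split; apply/eqP; rewrite -subr_eq0 -linearB ?Txp ?Qxp.
have px : `|p| ^+ 2 <= `|x| ^+ 2.
  have -> : `|x| ^+ 2 = `|p| ^+ 2 + `|x - p| ^+ 2.
    have o := orth_closed_span sp xp.
    rewrite -[in LHS](subrK p x); move: (x - p) o => q o.
    rewrite -!hdotxx hdotDl !hdotDr o (hdotC q p) o rmorph0.
    by rewrite add0r addr0 addrC.
  by rewrite lerDl exprn_ge0.
rewrite Tx Qx; apply: le_trans px.
pose g (y : E) : R[i] := `|y| ^+ 2 - (`|T y| ^+ 2 + `|Q y| ^+ 2).
have gr y : g y \is Num.real by rewrite rpredB ?rpredD ?rpredX ?normr_real.
rewrite -subr_ge0 -/(g p) real_leNgt ?rpred0 //; apply/negP => gp.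
have d0 : 0 < - g p by rewrite oppr_gt0.
have [e e0 eg] :=
  sqnorm_defect_continuous (@bop_cont _ _ _ T) (@bop_cont _ _ _ Q) p d0.
have [s /eg] := sp _ e0.
rewrite -/(g _) -/(g _) => /real_ltr_distlCDr; rewrite rpredB // subrr.
by move=> /(_ isT); rewrite real_ltNge ?rpred0 // subr_ge0 le_s.
Qed.

(** The adjoint is the easier operator to construct: F is sent to the vector of the
closed span that represents the functional comb a s |-> <comb t s, F>. This
avoids extending a |-> t by density, and as the adjoint takes its values in the
closed span, A vanishes on the orthogonal complement. *)
Lemma op_of_family (V : hilbertType R) (t : I -> V) :
  (forall s, `|comb t s| <= `|comb a s|) ->
  exists A : 'L(E, V), (forall i, A (a i) = t i) /\
    (forall x, (forall i, '[a i, x] = 0) -> A x = 0).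
Proof.
move=> ta.
have /choice[A' A'P] : forall F : V, exists z, [/\ in_closed_span z,
    `|z| <= `|F| & forall s, '[comb a s, z] = '[comb t s, F]].
  move=> F; apply: closed_span_riesz => [|k s s'||s] //.
  - by rewrite comb_nil hdot0l.
  - by rewrite comb_axpyE hdotDl hdotZl.
  - apply: le_trans (hilbert_cauchy_schwarz _ _) _.
    by rewrite mulrC ler_wpM2l.
have A'a i F : '[a i, A' F] = '[t i, F].
  by have [_ _ /(_ [:: (1, i)])] := A'P F; rewrite !comb_single.
have sA' F : in_closed_span (A' F) by have [] := A'P F.
have A'L : linear A'.
  move=> k F F'; apply: closed_span_inj => //; first exact: in_closed_span_axpy.
  by move=> i; rewrite hdotDr hdotZr !A'a hdotDr hdotZr.
pose L := GRing.isLinear.Build R[i] V E *:%R A' A'L.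
pose A'lin : {linear V -> E} := HB.pack A' L.
have A'c : continuous A'lin.
  apply/linear_bounded_continuous/linear_boundedP.
  near=> r => F; have [_ AF _] := A'P F; apply: le_trans AF _.
  by rewrite -[X in X <= _]mul1r ler_wpM2r.
pose Ab : 'L(V, E) := BoundedOp A'c.
exists (adj Ab); split=> [i|x ax]; apply: hdot_inj => F; rewrite -adjE /=.
  by rewrite hdotC A'a -hdotC.
rewrite [RHS]hdotC hdot0l rmorph0; exact: orth_closed_span.
Unshelve. all: by end_near. Qed.

End ClosedSpan.

(** * Adjoints, kernel sections and the ball *)

Lemma adjK (R : realType) (U V : hilbertType R) (T : 'L(U, V)) : adj (adj T) = T.
Proof.
apply: bop_eqP => x; apply: hdot_inj => y.
by rewrite -adjE hdotC -adjE [RHS]hdotC.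
Qed.

Section KernelSections.
Variables (R : realType) (T : Type) (H : hilbertType R) (K : rkhs T H).

Lemma hdot_ksec (f : K) w h : '[f, ksec K w h] = '[rk_ev K w f, h].
Proof. by rewrite adjE. Qed.

Lemma adj_ksec w : adj (ksec K w) = rk_ev K w.
Proof. exact: adjK. Qed.

Lemma ksec_total (f : K) : (forall p : T * H, '[ksec K p.1 p.2, f] = 0) -> f = 0.
Proof.
move=> f0; apply: rk_ext => w; rewrite linear0; apply: hdot_inj => h.
by rewrite [LHS]hdotC -hdot_ksec hdotC (f0 (w, h)) [RHS]hdotC hdot0l !rmorph0.
Qed.

End KernelSections.

Lemma hdot_dsum (R : realType) (V : hilbertType R) n (x y : dsum V n) :
  '[x, y] = \sum_(i < n) '[x i, y i].
Proof. by []. Qed.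

(** If z w^* = 1 with z and w in the ball, then (z - w)(z - w)^* < 0. *)
Lemma cball_cdot_neq1 (R : realType) d (z w : cball R d) :
  cdot (sval z) (sval w) != 1.
Proof.
case: z w => [z z1] [w w1] /=; apply/eqP => zw1.
have wz1 : cdot w z = 1.
  rewrite -[RHS](rmorph1 conjC) -zw1 /cdot rmorph_sum; apply: eq_bigr => j _.
  by rewrite rmorphM /= conjCK mulrC.
have : 0 <= cdot (z - w) (z - w).
  by apply: sumr_ge0 => j _; rewrite -normCK exprn_ge0.
have -> : cdot (z - w) (z - w) = cdot z z + cdot w w - (cdot z w + cdot w z).
  rewrite /cdot -!big_split -sumrB /=; apply: eq_bigr => j _.
  by rewrite !mxE rmorphB /=; ring.
by rewrite zw1 wz1 subr_ge0 real_leNgt ?ltrD // ger0_real // ?addr_ge0 //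
  sumr_ge0 // => j _; rewrite -normCK exprn_ge0.
Qed.

(** * Splitting the columns w^* k_w *)

Section GleasonProblem.
Variables (R : realType) (d : nat) (H : hilbertType R).
Variables (b : cball R d -> 'L(H, H)) (K : rkhs (cball R d) H).
Hypothesis K_kernel : has_kernel K (debranges_rovnyak_kernel b).
Local Notation Bd := (cball R d).
Local Notation Bd0 := (cball0 R d).
Implicit Types (p q : Bd * H) (w z : Bd) (g h : H) (f : K).

Let kf p : K := ksec K p.1 p.2.
Let cf p : H := adj (b p.1) p.2.
Let wf p : dsum K d := wstar_ksec K p.1 p.2.

Lemma ksec_gram w h z g :
  (1 - cdot (sval z) (sval w)) * '[ksec K w h, ksec K z g] =
  '[h, g] - '[adj (b w) h, adj (b z) g].
Proof.
rewrite hdot_ksec K_kernel /debranges_rovnyak_kernel hdotZl mulrA mulfV.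
  by rewrite mul1r hdotBl adjE.
by rewrite subr_eq0 eq_sym cball_cdot_neq1.
Qed.

Lemma ksec_at0 w h : rk_ev K Bd0 (ksec K w h) = h - b Bd0 (adj (b w) h).
Proof.
rewrite K_kernel /debranges_rovnyak_kernel /cdot big1 => [|j _].
  by rewrite subr0 invr1 scale1r.
by rewrite /= mxE mul0r.
Qed.

Lemma wstar_gram w h z g :
  '[wstar_ksec K w h, wstar_ksec K z g] =
  cdot (sval z) (sval w) * '[ksec K w h, ksec K z g].
Proof.
rewrite hdot_dsum /cdot mulr_suml; apply: eq_bigr => j _.
by rewrite !ffunE hdotZl hdotZr conjCK mulrA [_ * zcoord z j]mulrC.
Qed.

Lemma hdot_wstar (F : dsum K d) z g :
  '[F, wstar_ksec K z g] = '[\sum_(j < d) zcoord z j *: rk_ev K z (F j), g].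
Proof.
rewrite hdot_dsum hdot_suml; apply: eq_bigr => j _.
by rewrite !ffunE hdotZr conjCK hdot_ksec hdotZl.
Qed.

(** Tested against the columns z^* k_z g, the Gleason property of B involves B
alone, without its components. *)
Lemma gleason_solution_forP (B : 'L(H, dsum K d)) :
  gleason_solution_for b B <->
  forall h z g, '[B h, wstar_ksec K z g] = '[b z h - b Bd0 h, g].
Proof.
split=> [GB h z g|GB z h]; first by rewrite hdot_wstar GB.
apply: hdot_inj => g; rewrite [LHS]hdotC -GB hdot_wstar [RHS]hdotC.
by [].
Qed.

Lemma adj_row_entry (X : 'L(dsum K d, K)) j f : adj (row_entry X j) f = adj X f j.
Proof.
apply: hdot_inj => y; rewrite -!adjE /= adjE hdot_dsum (bigD1 j) //= ffunE eqxx.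
by rewrite big1 ?addr0 // => i /negPf ij; rewrite ffunE ij hdot0l.
Qed.

(** Equivalently, X maps z^* k_z g to k_z g - k_0 g. *)
Lemma gleason_solutionP (X : 'L(dsum K d, K)) :
  gleason_solution X <->
  forall f z g, '[adj X f, wstar_ksec K z g] = '[f, ksec K z g - ksec K Bd0 g].
Proof.
have E f z g : '[adj X f, wstar_ksec K z g] =
    '[\sum_(j < d) zcoord z j *: rk_ev K z (adj (row_entry X j) f), g].
  by rewrite hdot_wstar; under [in RHS]eq_bigr do rewrite adj_row_entry.
split=> [GX f z g|GX f z]; first by rewrite E GX hdotBl hdotBr !hdot_ksec.
apply: hdot_inj => g; rewrite [LHS]hdotC -E GX [RHS]hdotC.
by rewrite hdotBl hdotBr !hdot_ksec.
Qed.

Lemma contractive_rowP (X : 'L(dsum K d, K)) :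
  op_le (X \o adj X) (fun f => f - ksec K Bd0 (adj (ksec K Bd0) f)) <->
  forall f, `|adj X f| ^+ 2 + `|rk_ev K Bd0 f| ^+ 2 <= `|f| ^+ 2.
Proof.
have E f : ('[(X \o adj X) f, f] <= '[f - ksec K Bd0 (adj (ksec K Bd0) f), f]) =
    (`|adj X f| ^+ 2 + `|rk_ev K Bd0 f| ^+ 2 <= `|f| ^+ 2).
  rewrite -[(X \o adj X) f]/(X (adj X f)) -!hdotxx hdotBl.
  rewrite (adjE X) (adjE (ksec K Bd0)) adj_ksec.
  by rewrite lerBrDr.
by split=> h f; [rewrite -E|rewrite E].
Qed.

Lemma contractive_colP (B : 'L(H, dsum K d)) :
  op_le (adj B \o B) (fun h => h - adj (b Bd0) (b Bd0 h)) <->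
  forall h, `|B h| ^+ 2 + `|b Bd0 h| ^+ 2 <= `|h| ^+ 2.
Proof.
have E h : ('[(adj B \o B) h, h] <= '[h - adj (b Bd0) (b Bd0 h), h]) =
    (`|B h| ^+ 2 + `|b Bd0 h| ^+ 2 <= `|h| ^+ 2).
  rewrite -[(adj B \o B) h]/(adj B (B h)) -!hdotxx hdotBl.
  by rewrite (adjE (adj B)) (adjE (adj (b Bd0))) !adjK lerBrDr.
by split=> l h; [rewrite -E|rewrite E].
Qed.

(** The columns w^* k_w h split as u + t. Both operators give such a splitting, with
u = B b(w)^* h and t = X^* k_w h; when only one of them is given, the other
summand is defined by difference. *)
Section Splitting.
Variables (u t : Bd * H -> dsum K d).
Hypotheses (ut : forall p, u p + t p = wf p)
  (uw : forall p q, '[u p, wf q] = '[b q.1 (cf p) - b Bd0 (cf p), q.2]).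

(** Expanding <t, t'> = <wf - u, wf' - u'> leaves the cross terms <u, wf'>, which uw
evaluates, and <wf, wf'> = z w^* <k, k'>, which the kernel identity turns into
<k, k'> - <h, g> + <c, c'>. *)
Lemma splitting_gram p q :
  '[kf p, kf q] + ('[u p, u q] + '[b Bd0 (cf p), b Bd0 (cf q)]) =
  '[cf p, cf q] + ('[t p, t q] + '[rk_ev K Bd0 (kf p), rk_ev K Bd0 (kf q)]).
Proof.
have tE r : t r = wf r - u r by rewrite -ut addrC addKr.
have uwpq : '[u p, wf q] = '[cf p, cf q] - '[b Bd0 (cf p), q.2].
  by rewrite uw hdotBl adjE.
have wupq : '[wf p, u q] = '[cf p, cf q] - '[p.2, b Bd0 (cf q)].
  by rewrite hdotC uw hdotBl adjE rmorphB /= -!hdotC.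
have wfpq := wstar_gram p.1 p.2 q.1 q.2; rewrite -/(wf p) -/(wf q) in wfpq.
have := ksec_gram p.1 p.2 q.1 q.2.
rewrite -/(kf p) -/(kf q) -/(cf p) -/(cf q) => kk.
have kkE : '[kf p, kf q] = '[p.2, q.2] - '[cf p, cf q] + '[wf p, wf q].
  by rewrite wfpq -kk; ring.
rewrite !tE !ksec_at0 -/(cf p) -/(cf q) !hdotBl !hdotBr uwpq wupq kkE; ring.
Qed.

(** Contractivity of B on the span of cf (left) is contractivity of X on the span of
kf (right). *)
Lemma splitting_contractive s :
  (`|comb u s| ^+ 2 + `|b Bd0 (comb cf s)| ^+ 2 <= `|comb cf s| ^+ 2) =
  (`|comb t s| ^+ 2 + `|rk_ev K Bd0 (comb kf s)| ^+ 2 <= `|comb kf s| ^+ 2).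
Proof.
have E : `|comb kf s| ^+ 2 + (`|comb u s| ^+ 2 + `|b Bd0 (comb cf s)| ^+ 2) =
    `|comb cf s| ^+ 2 + (`|comb t s| ^+ 2 + `|rk_ev K Bd0 (comb kf s)| ^+ 2).
  rewrite !comb_linear !comb_gram -!big_split; apply: eq_bigr => p _.
  rewrite -!big_split; apply: eq_bigr => q _ /=.
  by rewrite -!mulrDr splitting_gram.
by rewrite -(lerD2l (`|comb kf s| ^+ 2)) E addrC lerD2r.
Qed.

End Splitting.

(** * From B to X *)

Lemma formula_splitting (B : 'L(H, dsum K d)) (X : 'L(dsum K d, K)) :
  gleason_formula b B X -> forall p, B (cf p) + adj X (kf p) = wf p.
Proof. by move=> FX p; rewrite FX addrC subrK. Qed.

Lemma col_wstar (B : 'L(H, dsum K d)) : gleason_solution_for b B ->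
  forall p q, '[B (cf p), wf q] = '[b q.1 (cf p) - b Bd0 (cf p), q.2].
Proof. by move=> /gleason_solution_forP GB p q; rewrite GB. Qed.

(** It suffices to compute <X z^* k_z g, k_w h> = <z^* k_z g, X^* k_w h> for all w
and h. *)
Lemma formula_gleason (B : 'L(H, dsum K d)) (X : 'L(dsum K d, K)) :
  gleason_solution_for b B -> gleason_formula b B X -> gleason_solution X.
Proof.
move=> GB FX; apply/gleason_solutionP => f z g.
suff E : X (wstar_ksec K z g) = ksec K z g - ksec K Bd0 g.
  by rewrite hdotC -adjE E -hdotC.
apply/eqP; rewrite -subr_eq0; apply/eqP/ksec_total => -[w h] /=.
have Bw : '[B (adj (b w) h), wstar_ksec K z g] =
    '[b z (adj (b w) h) - b Bd0 (adj (b w) h), g] := col_wstar GB (w, h) (z, g).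
rewrite hdotBr [X in X - _]hdotC adjE -hdotC FX hdotBl Bw wstar_gram.
rewrite hdotBr (hdot_ksec (ksec K w h) Bd0) ksec_at0 !hdotBl (adjE (b z)).
have -> : '[h, g] = (1 - cdot (sval z) (sval w)) * '[ksec K w h, ksec K z g]
    + '[adj (b w) h, adj (b z) g] by rewrite ksec_gram subrK.
ring.
Qed.

Lemma formula_contractive (B : 'L(H, dsum K d)) (X : 'L(dsum K d, K)) :
  contractive_gleason_solution_for b B -> gleason_formula b B X ->
  contractive_gleason_solution X.
Proof.
move=> [GB /contractive_colP CB] FX; split; first exact: formula_gleason FX.
apply/contractive_rowP => f; apply: (@contraction_closed_span _ _ _ kf).
  move=> s; rewrite comb_linear.
  rewrite -(splitting_contractive (formula_splitting FX) (col_wstar GB)).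
  by rewrite -(comb_linear B).
by move=> y /ksec_total ->; rewrite !linear0.
Qed.

Lemma extremal_contractive (B : 'L(H, dsum K d)) :
  extremal_gleason_solution_for b B -> contractive_gleason_solution_for b B.
Proof. by move=> [GB EB]; split=> // h; rewrite EB. Qed.

Lemma formula_extremal (B : 'L(H, dsum K d)) (X : 'L(dsum K d, K)) :
  extremal_gleason_solution_for b B -> gleason_formula b B X ->
  extremal_gleason_solution X.
Proof.
move=> [GB EB] FX; split; first exact: formula_gleason FX.
have kk p q : '[adj X (kf p), adj X (kf q)]
    + '[rk_ev K Bd0 (kf p), rk_ev K Bd0 (kf q)] = '[kf p, kf q].
  have := splitting_gram (formula_splitting FX) (col_wstar GB) p q.
  have -> : '[B (cf p), B (cf q)] + '[b Bd0 (cf p), b Bd0 (cf q)] = '[cf p, cf q].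
    have : adj B (B (cf p)) = cf p - adj (b Bd0) (b Bd0 (cf p)) := EB (cf p).
    move=> /(congr1 (fun x => '[x, cf q])).
    by rewrite hdotBl (adjE (adj B)) (adjE (adj (b Bd0))) !adjK => ->; rewrite subrK.
  by rewrite addrC => /addrI.
(* kk says that X X^* + k_0 k_0^* is the identity on kernel sections, which are
   total *)
have XXk q : X (adj X (kf q)) + ksec K Bd0 (rk_ev K Bd0 (kf q)) = kf q.
  apply/eqP; rewrite -subr_eq0; apply/eqP/ksec_total => p.
  by rewrite hdotBr hdotDr hdot_ksec -kk (hdotC _ (X _)) adjE -hdotC subrr.
move=> f; rewrite -[LHS]/(X (adj X f)); apply/eqP.
rewrite -subr_eq0; apply/eqP/ksec_total => q.
rewrite -/(kf q) hdotC opprB addrA hdotBl hdotDl.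
rewrite (adjE X) (adjE (ksec K Bd0)) adj_ksec (adjE (rk_ev K Bd0)).
rewrite (adjE (adj X)) adjK -hdotDr XXk subrr; exact: rmorph0.
Qed.

Lemma formula_unique (B : 'L(H, dsum K d)) (X X' : 'L(dsum K d, K)) :
  gleason_formula b B X -> gleason_formula b B X' -> X = X'.
Proof.
move=> FX FX'; apply: bop_eqP => F; apply/eqP; rewrite -subr_eq0.
apply/eqP/ksec_total => p.
rewrite hdotC hdotBl !adjE FX FX' subrr; exact: rmorph0.
Qed.

(** X^* is the operator k_w h |-> w^* k_w h - B b(w)^* h, which the contractivity of B
makes a contraction on the span of the kernel sections. *)
Lemma formula_exists (B : 'L(H, dsum K d)) :
  contractive_gleason_solution_for b B -> exists X, gleason_formula b B X.
Proof.
move=> [GB /contractive_colP CB].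
pose t p := wf p - B (cf p).
have ut p : B (cf p) + t p = wf p by rewrite addrC subrK.
have [|A [Ak _]] := @op_of_family _ _ _ kf _ t.
  move=> s; rewrite -ler_sqr ?nnegrE //.
  have := splitting_contractive ut (col_wstar GB) s.
  rewrite -comb_linear CB => /esym; apply: le_trans.
  by rewrite lerDl exprn_ge0.
by exists (adj A) => w h; rewrite adjK (Ak (w, h)).
Qed.

(** * From X to B *)

(** B is defined on the vectors b(w)^* h by the formula, and is zero on their
orthogonal complement; since every b(z) vanishes there too, the properties of B
need only be checked on the vectors b(w)^* h. *)
Lemma formula_onto (X : 'L(dsum K d, K)) : contractive_gleason_solution X ->
  exists2 B, contractive_gleason_solution_for b B & gleason_formula b B X.
Proof.
move=> [/gleason_solutionP GX /contractive_rowP CX].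
pose u p := wf p - adj X (kf p).
have ut p : u p + adj X (kf p) = wf p by rewrite subrK.
have uw p q : '[u p, wf q] = '[b q.1 (cf p) - b Bd0 (cf p), q.2].
  have := ksec_gram p.1 p.2 q.1 q.2; rewrite mulrBl mul1r -wstar_gram => kk.
  rewrite hdotBl GX hdotBr (hdot_ksec (kf p) Bd0) ksec_at0 !hdotBl.
  rewrite (adjE (b q.1)) -/(cf p).
  rewrite -/(cf q) -/(cf p) in kk.
  have -> : '[kf p, ksec K q.1 q.2] = '[p.2, q.2] - '[cf p, cf q] + '[wf p, wf q].
    by rewrite -kk subrK.
  rewrite /cf; ring.
have ucon s : `|comb u s| ^+ 2 + `|b Bd0 (comb cf s)| ^+ 2 <= `|comb cf s| ^+ 2.
  by rewrite (splitting_contractive ut uw) -comb_linear.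
have [|B [Bc B0]] := @op_of_family _ _ _ cf _ u.
  move=> s; rewrite -ler_sqr ?nnegrE //; apply: le_trans (ucon s).
  by rewrite lerDl exprn_ge0.
have b0 z y : (forall p, '[cf p, y] = 0) -> b z y = 0.
  move=> cy; apply: hdot_inj => g; rewrite [LHS]hdotC adjE -hdotC.
  by rewrite (cy (z, g)) [RHS]hdotC hdot0l rmorph0.
exists B; last by move=> w h; rewrite (Bc (w, h)) opprB addrC subrK.
split.
  apply/gleason_solution_forP => h z g.
  (* the identity to prove reads <h, v> = 0, so it suffices that v = 0; as v is
     orthogonal to the cf p, the operators B, b z and b 0 vanish at v *)
  pose v := adj B (wstar_ksec K z g) - (adj (b z) g - adj (b Bd0) g).
  have hv y : '[y, v] = '[B y, wstar_ksec K z g] - '[b z y - b Bd0 y, g].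
    by rewrite !(hdotBr, hdotBl) !adjE.
  have cv p : '[cf p, v] = 0 by rewrite hv Bc (uw p (z, g)) subrr.
  have v0 : v = 0.
    apply/eqP; rewrite -normr_eq0 -sqrf_eq0 -hdotxx hv B0 // !b0 //.
    by rewrite subrr !hdot0l subrr.
  by apply/eqP; rewrite -subr_eq0 -hv v0 hdotC hdot0l rmorph0.
apply/contractive_colP => h; apply: (@contraction_closed_span _ _ _ cf).
  move=> s; rewrite comb_linear; have := ucon s.
  have -> : comb u s = comb (fun p => B (cf p)) s.
    by apply: eq_bigr => p _; rewrite Bc.
  by [].
by move=> y cy; rewrite B0 // b0.
Qed.

End GleasonProblem.

(** * The correspondence *)

Theorem theorem4p4 (R : realType) (d : nat) (hd : (0 < d)%N)
    (H : hilbertType R) (H_nonzero : exists h : H, h != 0)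
    (H_size : finite_dimensional H \/ separable_space H)
    (D : rkhs (cball R d) H) (D_kernel : has_kernel D (@drury_arveson_kernel R d H))
    (b : cball R d -> 'L(H, H))
    (b_schur : multiplier_unit_ball D b) (b_pure : purely_contractive b)
    (K : rkhs (cball R d) H) (K_kernel : has_kernel K (debranges_rovnyak_kernel b)) :
  (forall X : 'L(dsum K d, K),
     contractive_gleason_solution X <->
     exists2 B : 'L(H, dsum K d),
       contractive_gleason_solution_for b B & gleason_formula b B X) /\
  (exists XB : 'L(H, dsum K d) -> 'L(dsum K d, K),
     [/\ forall B, contractive_gleason_solution_for b B ->
            forall X, gleason_formula b B X <-> X = XB B,
         set_fun [set B | contractive_gleason_solution_for b B]
           [set X | contractive_gleason_solution X] XB,
         set_surj [set B | contractive_gleason_solution_for b B]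
           [set X | contractive_gleason_solution X] XB
       & forall B, extremal_gleason_solution_for b B ->
            extremal_gleason_solution (XB B)]).
Proof.
split=> [X|].
  split; first exact: formula_onto.
  by move=> [B CB FX]; exact: (formula_contractive K_kernel CB FX).
have /choice[XB XBP] : forall B : 'L(H, dsum K d), exists X : 'L(dsum K d, K),
    contractive_gleason_solution_for b B -> gleason_formula b B X.
  move=> B; have [CB|nCB] := pselect (contractive_gleason_solution_for b B).
    by have [X FX] := formula_exists K_kernel CB; exists X.
  (* any operator will do when B is not contractive *)
  by exists (dsum_pr K (Ordinal hd)).
exists XB; split.
- move=> B CB X; split=> [FX|->]; last exact: XBP.
  exact: formula_unique FX (XBP B CB).
- by move=> B /= CB; exact: (formula_contractive K_kernel CB (XBP B CB)).
- move=> X /= CX; have [B CB FX] := formula_onto K_kernel CX.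
  by exists B => //; exact: formula_unique (XBP B CB) FX.
- move=> B EB; apply: (formula_extremal K_kernel EB).
  exact: XBP (extremal_contractive EB).
Qed.
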